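(* There exists a deterministic distributed algorithm in the CONGEST model that, given an $n$-node graph $G$ together with a clique edge cover $Q$ of $G$ of diversity $D$ (each node knowing the cliques of $Q$ containing it), computes a $(D+4)$-ruling set of $G$ (i.e. a $(2,D+4)$-ruling set) in $O(D+\log^* n)$ rounds.
   Context: CONGEST model: the network is an $n$-node graph $G=(V,E)$; each node has a unique $O(\log n)$-bit ID; computation proceeds in synchronous rounds, in each of which every node may send a message of $O(\log n)$ bits to each neighbor and perform unbounded local computation. A clique edge cover of $G$ is a collection $Q$ of cliques (complete subgraphs) of $G$ such that every node of $G$ lies in at least one clique of $Q$ and for every edge $\{u,v\}\in E$ there is a clique $C\in Q$ containing both $u$ and $v$. The diversity of $(G,Q)$ is $\max_{v\in V}|\{C\in Q: v\in C\}|$. An $(\alpha,\beta)$-ruling set of $G$ is a set $R\subseteq V$ such that any two distinct nodes of $R$ are at distance at least $\alpha$ in $G$ and every $v\in V$ has some $u\in R$ with $\mathrm{dist}_G(u,v)\leq\beta$; a $\beta$-ruling set is a $(2,\beta)$-ruling set. *)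

(* Defs.v *)
From mathcomp Require Import all_boot.
From mathcomp Require Import finmap.

Set Implicit Arguments.
Unset Strict Implicit.
Unset Printing Implicit Defensive.

(** * Graphs *)

(* The relation [e] is the adjacency relation of a simple graph on [V]. *)
Definition simple_graph (V : finType) (e : rel V) : Prop :=
  symmetric e /\ irreflexive e.

(* The distance is the least length (number of edges) of a walk; it is infinite
   when there is none, so [dist_ge] holds and [dist_le] fails for nodes in
   different components. *)
Definition dist_le (V : finType) (e : rel V) (u v : V) (k : nat) : Prop :=
  exists p : seq V, [/\ path e u p, last u p = v & size p <= k].

Definition dist_ge (V : finType) (e : rel V) (u v : V) (k : nat) : Prop :=
  forall p : seq V, path e u p -> last u p = v -> k <= size p.

Definition ruling_set (V : finType) (e : rel V) (alpha beta : nat)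
    (R : {set V}) : Prop :=
  (forall u v : V, u \in R -> v \in R -> u <> v -> dist_ge e u v alpha) /\
  (forall v : V, exists2 u : V, u \in R & dist_le e u v beta).

Definition clique (V : finType) (e : rel V) (C : {set V}) : Prop :=
  forall u v : V, u \in C -> v \in C -> u <> v -> e u v.

Definition clique_edge_cover (V : finType) (e : rel V) (Q : {set {set V}}) :
    Prop :=
  [/\ forall C : {set V}, C \in Q -> clique e C,
      forall v : V, exists2 C : {set V}, C \in Q & v \in C
    & forall u v : V, e u v ->
        exists C : {set V}, [/\ C \in Q, u \in C & v \in C]].

Definition diversity (V : finType) (Q : {set {set V}}) : nat :=
  \max_(v : V) #|[set C in Q | v \in C]|.

(** * Logarithms *)

(* The number of binary digits of [n] if [0 < n], and 1 if [n = 0]: a positive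
   quantity of order [log n]. *)
Definition bitlen (n : nat) : nat := (trunc_log 2 n).+1.

Lemma log_star_ex (n : nat) : exists k, iter k (up_log 2) n <= 1.
Proof.
elim/ltn_ind: n => n IHn.
have [n_le1|n_gt1] := leqP n 1; first by exists 0.
have [|k Hk] := IHn (up_log 2 n); last by exists k.+1; rewrite iterSr.
have n_pred : n = n.-1.+1 by rewrite prednK // ltnW.
rewrite [X in _ < X]n_pred ltnS.
by apply: up_log_min => //; rewrite [X in X <= _]n_pred ltn_expl.
Qed.

(* Rounding the binary logarithm up at each step does not change the number of
   steps needed to reach a value at most 1. *)
Definition log_star (n : nat) : nat := ex_minn (log_star_ex n).

(** * The CONGEST model *)

(* A deterministic algorithm, run by every node, with local inputs in [I] and
   local outputs in [O]. Nodes are addressed by their IDs.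
   [init n i N x] is the initial state of a node of ID [i] in an [n]-node
   network whose neighbors have the IDs in [N] and whose local input is [x].
   [send s j] is the message sent from state [s] to the neighbor of ID [j].
   [recv s m] is the next state, [m j] being the message from the neighbor of
   ID [j]. The empty bit string stands for the absence of a message.
   A node stops as soon as [output] is not [None]. *)
Record algorithm (I O : Type) := Algorithm {
  state : Type;
  init : nat -> nat -> {fset nat} -> I -> state;
  send : state -> nat -> seq bool;
  recv : state -> (nat -> seq bool) -> state;
  output : state -> option O
}.

(* A node that has stopped sends nothing and keeps its state. *)
Definition message (I O : Type) (A : algorithm I O) (s : state A) (j : nat) :
    seq bool :=
  if output s is Some _ then [::] else send s j.

Definition inbox (I O : Type) (A : algorithm I O) (V : finType) (e : rel V)
    (id : V -> nat) (s : V -> state A) (v : V) (j : nat) : seq bool :=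
  if [pick u : V | e u v && (id u == j)] is Some u then message (s u) (id v)
  else [::].

Definition round (I O : Type) (A : algorithm I O) (V : finType) (e : rel V)
    (id : V -> nat) (s : V -> state A) (v : V) : state A :=
  if output (s v) is Some _ then s v else recv (s v) (inbox e id s v).

Definition run (I O : Type) (A : algorithm I O) (V : finType) (e : rel V)
    (id : V -> nat) (x : V -> I) (t : nat) : V -> state A :=
  iter t (round e id)
    (fun v => init A #|V| (id v) [fset id u | u in e v]%fset (x v)).

(* Unique IDs of at most [c * bitlen #|V|] bits. *)
Definition valid_ids (V : finType) (c : nat) (id : V -> nat) : Prop :=
  injective id /\ forall v : V, id v < 2 ^ (c * bitlen #|V|).

Definition bandwidth_le (I O : Type) (A : algorithm I O) (V : finType)
    (e : rel V) (id : V -> nat) (x : V -> I) (w : nat) : Prop :=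
  forall (t : nat) (u v : V), e u v ->
    size (message (run A e id x t u) (id v)) <= w.

(* After [t] rounds every node has stopped, and the nodes that output [true]
   are those of [R]. *)
Definition computes_in (I : Type) (A : algorithm I bool) (V : finType)
    (e : rel V) (id : V -> nat) (x : V -> I) (t : nat) (R : {set V}) : Prop :=
  forall v : V, output (run A e id x t v) = Some (v \in R).

(* The cliques of [Q] containing [v], each given as the set of the IDs of its
   members. *)
Definition clique_input (V : finType) (id : V -> nat) (Q : {set {set V}})
    (v : V) : {fset {fset nat}} :=
  [fset [fset id u | u in C] | C : {set V} in [set C in Q | v \in C]]%fset.

(* Main.v *)
Require Import Defs.
From mathcomp Require Import all_boot.
From mathcomp Require Import finmap.
From mathcomp Require Import all_algebra all_field zify.

(* Let [k v] be the number of cliques at [v]. In each stage every clique nominates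
   one active member that it has not nominated before; a node stays active if
   some clique nominates it, or if all its cliques have already done so. A node
   that drops out has a clique that nominates another member, which stays active:
   a stage costs distance 1. A node that stays active gains a nominating clique
   until it has them all, so nothing changes after [D] stages.

   Let [2 ^ l] be [k v] rounded up to a power of two. Since a clique nominates at
   most one node per stage, an active node of level [l] has at most [4 ^ l] active
   neighbors of level [l] after [2 ^ l] stages. Linial's color reduction, with
   polynomials over GF(2^k), brings the IDs of the active nodes of each level down
   to fewer than [(4 * 2 ^ l) ^ 4] colors in [log* n + O(1)] rounds. Read in base
   [4 * 2 ^ l], a color has four digits; letting the active nodes of smaller
   digit eliminate their neighbors of larger digit, one digit value per round, one
   position after the other, costs [O(2 ^ l)] rounds and distance 4.

   The nodes do not know [D]: the levels use disjoint time windows of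
   geometrically growing lengths, and the nodes selected at one level eliminate
   their neighbors of higher levels. *)

Set Implicit Arguments.
Unset Strict Implicit.
Unset Printing Implicit Defensive.

(** * Binary words and digits *)

Fixpoint to_bits (w m : nat) : seq bool :=
  if w is w'.+1 then odd m :: to_bits w' m./2 else [::].

Definition of_bits (s : seq bool) : nat :=
  foldr (fun (b : bool) m => b + m.*2) 0 s.

Lemma size_to_bits w m : size (to_bits w m) = w.
Proof. by elim: w m => //= w IHw m; rewrite IHw. Qed.

Lemma to_bitsK w m : m < 2 ^ w -> of_bits (to_bits w m) = m.
Proof.
elim: w m => [|w IHw] m /=; first by rewrite expn0; case: m.
rewrite expnS => m_lt; rewrite IHw ?odd_double_half //; lia.
Qed.

Definition digit (B i m : nat) : nat := (m %/ B ^ i) %% B.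

Lemma digit_inj B d x y : 0 < B -> x < B ^ d -> y < B ^ d ->
  (forall i, i < d -> digit B i x = digit B i y) -> x = y.
Proof.
move=> B_gt0; elim: d x y => [|d IHd] x y.
  by rewrite expn0 !ltnS !leqn0 => /eqP -> /eqP ->.
rewrite !expnSr -!ltn_divLR // => x_lt y_lt eq_xy.
have eq_mod : x %% B = y %% B.
  by have := eq_xy 0 isT; rewrite /digit expn0 !divn1.
rewrite (divn_eq x B) (divn_eq y B) eq_mod (IHd _ _ x_lt y_lt) // => i i_lt.
by have := eq_xy i.+1 i_lt; rewrite /digit expnS !divnMA.
Qed.

(** * Colors as polynomials over GF(2^k) *)

(* The predecessor makes the exponent positive; the junk case is [k = 0]. *)
Definition gf2 (k : nat) : finFieldType :=
  s2val (pPrimePowerField (isT : prime 2) (ltn0Sn k.-1)).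

Lemma card_gf2 k : 0 < k -> #|gf2 k| = 2 ^ k.
Proof.
by move=> k_gt0; rewrite /gf2; case: pPrimePowerField => F /= _ ->; rewrite prednK.
Qed.

(** The number [x] indexes the vectors of [d.+1] coefficients; out of range it gives the zero
    polynomial. *)
Definition nth_poly (k d x : nat) : {poly gf2 k} :=
  \poly_(j < d.+1) nth [ffun=> 0%R] (enum {ffun 'I_d.+1 -> gf2 k}) x (inord j).

Lemma nth_poly_inj k d x y : x < #|gf2 k| ^ d.+1 -> y < #|gf2 k| ^ d.+1 ->
  nth_poly k d x = nth_poly k d y -> x = y.
Proof.
have -> : #|gf2 k| ^ d.+1 = size (enum {ffun 'I_d.+1 -> gf2 k}).
  by rewrite -cardE card_ffun card_ord.
move=> x_lt y_lt eq_xy; apply/eqP.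
rewrite -(nth_uniq [ffun=> 0%R] x_lt y_lt (enum_uniq _)); apply/eqP/ffunP => j.
have := congr1 (fun p : {poly _} => p`_j)%R eq_xy.
by rewrite !coef_poly ltn_ord inord_val.
Qed.

(* The color [x] stands for a polynomial; the code keeps the evaluation point [i]
   beside the value, so colors computed from different points differ. *)
Definition code (k d x i : nat) : nat :=
  let F := gf2 k in
  i * #|F| + index (nth_poly k d x).[nth 0%R (enum F) i]%R (enum F).

Lemma code_lt k d x i : i < #|gf2 k| -> code k d x i < #|gf2 k| ^ 2.
Proof.
move=> i_lt; rewrite /code; set y := index _ _.
have y_lt : y < #|gf2 k| by rewrite cardE index_mem mem_enum.
rewrite expnS expn1; nia.
Qed.

Lemma code_inj_point k d x y i j : code k d x i = code k d y j -> i = j.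
Proof.
rewrite /code; set u := index _ _; set v := index _ _ => /eqP.
have u_lt : u < #|gf2 k| by rewrite cardE index_mem mem_enum.
have v_lt : v < #|gf2 k| by rewrite cardE index_mem mem_enum.
move=> /eqP /(congr1 (fun m => m %/ #|gf2 k|)).
by rewrite !divnMDl ?(leq_ltn_trans _ u_lt) // !divn_small ?addn0.
Qed.

(** At a point where the codes agree, the difference of the two polynomials vanishes; it is nonzero
    of degree at most [d]. *)
Lemma count_code_eq k d x y :
  x < #|gf2 k| ^ d.+1 -> y < #|gf2 k| ^ d.+1 -> x != y ->
  count (fun i => code k d x i == code k d y i) (iota 0 #|gf2 k|) <= d.
Proof.
move=> x_lt y_lt /eqP neq_xy; set F := gf2 k.
pose p := (nth_poly k d x - nth_poly k d y)%R.
have p_neq0 : p != 0%R.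
  by rewrite GRing.subr_eq0; apply/eqP => /(nth_poly_inj x_lt y_lt).
have size_p : size p <= d.+1.
  by rewrite (leq_trans (size_polyD _ _)) // size_polyN geq_max !size_poly.
rewrite -size_filter -(size_map (nth 0%R (enum F))) -ltnS.
apply: leq_trans size_p; apply: max_poly_roots => //.
  apply/allP => z /mapP[i]; rewrite mem_filter => /andP[/eqP eq_code _] ->.
  rewrite rootE !hornerE GRing.subr_eq0; apply/eqP.
  move: eq_code; rewrite /code => /addnI /(congr1 (nth 0%R (enum F))).
  by rewrite !nth_index ?mem_enum.
rewrite map_inj_in_uniq ?filter_uniq ?iota_uniq // => i j.
rewrite !mem_filter !mem_iota !add0n cardE => /andP[_ /= i_lt] /andP[_ /= j_lt] /eqP.
by rewrite nth_uniq ?enum_uniq // => /eqP.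
Qed.

(** Entries equal to [x] are ignored: nodes that have dropped out are recolored too, and their lists
    may contain their own color. *)
Definition fresh_point (k d x : nat) (Y : seq nat) : nat :=
  find (fun i => all (fun y => (y == x) || (code k d x i != code k d y i)) Y)
    (iota 0 #|gf2 k|).

(** Each [y] other than [x] spoils at most [d] points, so fewer than [#|gf2 k|] points are spoiled
    altogether. *)
Lemma fresh_pointP k d x Y : size Y * d < #|gf2 k| -> x < #|gf2 k| ^ d.+1 ->
  (forall y, y \in Y -> y < #|gf2 k| ^ d.+1) ->
  fresh_point k d x Y < #|gf2 k| /\
  forall y, y \in Y -> y != x ->
    code k d x (fresh_point k d x Y) != code k d y (fresh_point k d x Y).
Proof.
move=> size_Y x_lt Y_lt; rewrite /fresh_point; set P := (P in find P _).
have : has P (iota 0 #|gf2 k|).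
  apply: contraLR size_Y => /hasPn noP; rewrite -leqNgt.
  pose bad y i := (y != x) && (code k d x i == code k d y i).
  have all_bad : count (fun i => has (bad^~ i) Y) (iota 0 #|gf2 k|) = #|gf2 k|.
    rewrite -[RHS](size_iota 0) -[in RHS]count_predT.
    apply: eq_in_count => i /noP; rewrite /P -has_predC => /hasP[y Yy].
    by rewrite /= negb_or negbK => y_bad; apply/hasP; exists y.
  rewrite -{}[leqLHS]all_bad.
  elim: Y Y_lt {P noP} => [|y Y IHY] Y_lt /=; first by rewrite count_pred0.
  rewrite mulSn; apply: (@leq_trans (count (bad y) (iota 0 #|gf2 k|) +
      count (fun i => has (bad^~ i) Y) (iota 0 #|gf2 k|))).
    by rewrite -count_predUI leq_addr.
  rewrite leq_add ?IHY // => [|z Yz]; last by rewrite Y_lt // in_cons Yz orbT.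
  rewrite /bad; have [->|neq_yx] := eqVneq y x; first by rewrite /= count_pred0.
  rewrite /=; apply: count_code_eq; first exact: x_lt.
    by rewrite Y_lt ?mem_head.
  by rewrite eq_sym.
move=> hasP'; split; first by rewrite has_find size_iota in hasP'.
have := nth_find 0 hasP'; rewrite nth_iota; last by rewrite has_find size_iota in hasP'.
rewrite add0n => /allP allY y Yy neq_yx.
by have := allY y Yy; rewrite (negbTE neq_yx).
Qed.

(** * One step of Linial's color reduction *)

(* From [2 ^ s] colors and at most [2 ^ a] neighbors, Linial's step over GF(2^k)
   with polynomials of degree at most [d] needs [s <= (d + 1) * k] and
   [2 ^ a * d < 2 ^ k], and leaves [2 ^ (2 * k)] colors. The first case is the last
   useful step; the second one replaces [s] by about [2 * (a + log s)]. *)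
Definition field_deg (a s : nat) : nat :=
  if s <= 8 * (a + 3) then a + 3 else a + bitlen s.

Definition poly_deg (a s : nat) : nat := if s <= 8 * (a + 3) then 7 else s.

Definition shrink (a s : nat) : nat := minn s (2 * field_deg a s).

(* A step that would not reduce the number of colors is skipped: colors never get
   longer than the IDs, even when [2 ^ a] exceeds the number of nodes. *)
Definition recolor (a s x : nat) (Y : seq nat) : nat :=
  let k := field_deg a s in let d := poly_deg a s in
  if s <= 2 * k then x else code k d x (fresh_point k d x Y).

Lemma bitlen_gt n : n < 2 ^ bitlen n.
Proof. exact: trunc_log_ltn. Qed.

Lemma bitlen_min n k : n < 2 ^ k -> 0 < k -> bitlen n <= k.
Proof.
move=> n_lt k_gt0; rewrite /bitlen; case: n n_lt => [|n] n_lt.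
  by rewrite trunc_log0.
by rewrite -(ltn_exp2l _ _ (ltnSn 1)); apply: leq_ltn_trans n_lt; exact: trunc_logP.
Qed.

Lemma card_gf2_field_deg a s : #|gf2 (field_deg a s)| = 2 ^ field_deg a s.
Proof. by apply: card_gf2; rewrite /field_deg /bitlen; case: ifP; lia. Qed.

Lemma field_deg_enough a s : 2 ^ s <= #|gf2 (field_deg a s)| ^ (poly_deg a s).+1.
Proof.
rewrite card_gf2_field_deg -expnM leq_exp2l // /field_deg /poly_deg /bitlen.
by case: ifP; lia.
Qed.

Lemma poly_deg_lt a s m : m <= 2 ^ a -> m * poly_deg a s < #|gf2 (field_deg a s)|.
Proof.
move=> m_le; apply: leq_ltn_trans (leq_mul m_le (leqnn _)) _.
rewrite card_gf2_field_deg /field_deg /poly_deg.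
by case: ifP => _; rewrite expnD ltn_pmul2l ?expn_gt0 ?bitlen_gt.
Qed.

Section Recolor.

Variables (a s x y : nat) (X Y : seq nat).
Hypotheses (size_X : size X <= 2 ^ a) (x_lt : x < 2 ^ s).
Hypothesis X_lt : forall z, z \in X -> z < 2 ^ s.

Let enough z : z < 2 ^ s -> z < #|gf2 (field_deg a s)| ^ (poly_deg a s).+1.
Proof. by move=> z_lt; apply: leq_trans z_lt (field_deg_enough a s). Qed.

Lemma recolor_lt : recolor a s x X < 2 ^ shrink a s.
Proof.
have [|px_lt _] := fresh_pointP (poly_deg_lt s size_X) (enough x_lt).
  by move=> z /X_lt/enough.
rewrite /recolor /shrink; case: (leqP s (2 * field_deg a s)) => [//|_].
by rewrite mulnC expnM -card_gf2_field_deg code_lt.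
Qed.

(** Equal codes would come from the same evaluation point, and the point chosen for [x] separates
    [x] from [y]. It is enough that one of the two lists contains the other color. *)
Lemma recolor_neq : x != y -> y \in X -> recolor a s x X != recolor a s y Y.
Proof.
move=> neq_xy Xy; have [|_ px_neq] := fresh_pointP (poly_deg_lt s size_X) (enough x_lt).
  by move=> z /X_lt/enough.
rewrite /recolor; case: ifP => // _.
apply: contra_neq (px_neq y Xy _) => [eq_code|]; last by rewrite eq_sym.
by rewrite [in RHS](code_inj_point eq_code).
Qed.

End Recolor.

(** * Number of color reduction steps *)

Lemma shrink_le a s : shrink a s <= s.
Proof. exact: geq_minl. Qed.

Lemma leq_iter_shrink a i s : iter i (shrink a) s <= s.
Proof. by elim: i => //= i; apply: leq_trans; exact: shrink_le. Qed.

Lemma bitlenM m n : bitlen (m * n) <= bitlen m + bitlen n.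
Proof.
by apply: bitlen_min => //; rewrite expnD ltn_mul ?bitlen_gt.
Qed.

Lemma bitlenS_up_log n : bitlen n.+1 <= (up_log 2 n).+2.
Proof.
apply: bitlen_min => //; have := up_logP n (ltnSn 1).
by have : 0 < 2 ^ up_log 2 n by [rewrite expn_gt0]; rewrite !expnS; lia.
Qed.

Lemma bitlen_le n : 0 < n -> bitlen n <= n.
Proof. by move=> n_gt0; apply: bitlen_min; rewrite // ltn_expl. Qed.

(** The constants are chosen so that [2 * (a + bitlen s) < s] as soon as [s > 8 * (a + 3)]. *)
Lemma bitlen_sublinear s : 8 * bitlen s <= 3 * s + 24.
Proof.
case: (posnP s) => [->|s_gt0]; first by rewrite /bitlen trunc_log0.
have := trunc_logP (ltnSn 1) s_gt0; rewrite /bitlen; set t := trunc_log 2 s.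
suff : 8 * t <= 3 * 2 ^ t + 16 by lia.
elim: t => // t IHt; rewrite expnS.
case: t IHt => [|[|[|t]]] //; rewrite !expnS; have : 0 < 2 ^ t by rewrite expn_gt0.
lia.
Qed.

Lemma shrink_final a s : s <= 8 * (a + 3) -> shrink a s <= 2 * (a + 3).
Proof. by rewrite /shrink /field_deg => ->; exact: geq_minr. Qed.

Lemma shrink_decr a s : 8 * (a + 3) < s -> shrink a s < s.
Proof.
move=> s_gt; have := bitlen_sublinear s.
by rewrite /shrink /field_deg (leqNgt s) s_gt /=; lia.
Qed.

(** So large a result comes from the second case of [field_deg] and forces [bitlen s > 3 * a]. *)
Lemma shrink_log a s : 8 * (a + 3) < shrink a s -> shrink a s <= 3 * bitlen s.
Proof. by rewrite /shrink /field_deg; case: ifP; lia. Qed.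

Lemma iter_shrink_decr a i s :
  iter i (shrink a) s <= maxn (8 * (a + 3)) (s - i).
Proof.
elim: i => [|i IHi] /=; first by rewrite subn0 leq_maxr.
set r := iter i _ _ in IHi *; have := @shrink_decr a r; have := shrink_le a r.
lia.
Qed.

(** The bound [s <= 2 ^ p * n.+1] is an invariant when [s] is shrunk and [n] replaced by its
    logarithm; at [n <= 1] it reads [s <= 2 ^ p.+1]. *)
Lemma iter_shrink_log p a i n s : 5 <= p -> iter i (up_log 2) n <= 1 ->
  s <= 2 ^ p * n.+1 ->
  iter i (shrink a) s <= maxn (8 * (a + 3)) (2 ^ p.+1).
Proof.
move=> p_ge5; elim: i n s => [|i IHi] n s.
  by rewrite /= expnS => n_le1 s_le; rewrite leq_max; nia.
rewrite !iterSr => n_le s_le.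
have [s'_le|s'_gt] := leqP (shrink a s) (8 * (a + 3)).
  by rewrite leq_max (leq_trans (leq_iter_shrink _ _ _)).
apply: IHi n_le _; apply: leq_trans (shrink_log s'_gt) _.
have bit_le : bitlen s <= p.+1 + (up_log 2 n).+2.
  apply: leq_trans (_ : bitlen (2 ^ p * n.+1) <= _).
    by apply: bitlen_min => //; apply: leq_ltn_trans s_le (bitlen_gt _).
  apply: leq_trans (bitlenM _ _) _.
  by rewrite /bitlen trunc_expnK // leq_add2l bitlenS_up_log.
(* This makes [3 * (p + up_log 2 n + 3)] at most [2 ^ p * (up_log 2 n).+1]; 5 is the least possible
   start. *)
have p_large : 3 * p + 9 <= 2 ^ p.
  elim: p p_ge5 {s_le bit_le} => // p IHp; rewrite leq_eqVlt => /predU1P[<- //|].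
  by rewrite ltnS => /IHp; rewrite expnS; lia.
nia.
Qed.

Lemma log_starP n : iter (log_star n) (up_log 2) n <= 1.
Proof. by rewrite /log_star; case: ex_minnP. Qed.

(* After [log_star n] steps the bit length is at most [2 ^ (c + 6)], unless the last
   useful step already applies; from then on each step decreases it until it does. *)
Definition color_rounds (c n : nat) : nat := log_star n + 2 ^ (c + 6) + 1.

Lemma color_bits_final c n a : 0 < n ->
  iter (color_rounds c n) (shrink a) (c * bitlen n) <= 2 * (a + 3).
Proof.
move=> n_gt0; rewrite /color_rounds -addnA addnC iterD addn1 iterS.
apply: shrink_final; apply: leq_trans (iter_shrink_decr _ _ _) _.
have s_le : c * bitlen n <= 2 ^ (c + 5) * n.+1.
  have := bitlen_le n_gt0; have := ltn_expl c (ltnSn 1); rewrite expnD; nia.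
have := @iter_shrink_log (c + 5) a (log_star n) n _ (leq_addl _ _) (log_starP n) s_le.
by rewrite (_ : (c + 5).+1 = c + 6); lia.
Qed.

(** * Nomination stages *)

(** The choice follows the order of the finite set [C], so all members of a clique compute the same
    nominee. *)
Definition nominee (al : nat -> bool) (old : seq nat) (C : {fset nat}) : option nat :=
  ohead [seq j <- C | al j & j \notin old].

Definition survives (i : nat) (picked : {fset nat} -> option nat)
    (old : {fset nat} -> seq nat) (X : {fset {fset nat}}) : bool :=
  has (fun C => picked C == Some i) X || all (fun C => i \in old C) X.

Lemma eq_nominee (al1 al2 : nat -> bool) (old1 old2 : seq nat) (C : {fset nat}) :
  {in C, al1 =1 al2} -> old1 = old2 -> nominee al1 old1 C = nominee al2 old2 C.
Proof.
by move=> eq_al ->; rewrite /nominee; congr ohead; apply: eq_in_filter => j /eq_al ->.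
Qed.

Lemma nomineeP (al : nat -> bool) (old : seq nat) (C : {fset nat}) j :
  nominee al old C = Some j -> [/\ j \in C, al j & j \notin old].
Proof.
rewrite /nominee; case Ds: [seq _ <- _ | _] => [|i s] //= [<-].
have : i \in [seq j <- C | al j & j \notin old] by rewrite Ds mem_head.
by rewrite mem_filter => /andP[/andP[]].
Qed.

Lemma nominee_some (al : nat -> bool) (old : seq nat) (C : {fset nat}) j :
  j \in C -> al j -> j \notin old -> nominee al old C.
Proof.
move=> Cj al_j old_j; rewrite /nominee; case Ds: [seq _ <- _ | _] => [|i s] //=.
have : j \in [seq j <- C | al j & j \notin old] by rewrite mem_filter al_j old_j.
by rewrite Ds.
Qed.

Lemma ltn_count (T : eqType) (a b : pred T) (s : seq T) x :
  subpred a b -> x \in s -> b x -> ~~ a x -> count a s < count b s.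
Proof.
move=> sub_ab s_x b_x not_a_x.
have -> : count b s = count a s + count (predD b a) s.
  rewrite -count_predUI [X in _ + X](_ : _ = 0) ?addn0.
    by apply: eq_count => y /=; case: (a y) (sub_ab y) => //= ->.
  by rewrite -(count_pred0 s); apply: eq_count => y /=; case: (a y).
by rewrite -addn1 leq_add2l -has_count; apply/hasP; exists x; rewrite //= not_a_x.
Qed.

Section Elimination.

Variables (V : finType) (e : rel V) (id : V -> nat) (Q : {set {set V}}).
Hypothesis id_inj : injective id.
Hypothesis cover : clique_edge_cover e Q.

Local Notation X := (clique_input id Q).

Definition level (v : V) : nat := up_log 2 #|` X v|.

(* A node announces itself only during its first [2 ^ level] stages: all its
   cliques have then nominated it, so that it no longer matters to them. *)
Fixpoint stage (t : nat) : (V -> bool) * ({fset nat} -> seq nat) :=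
  if t is t'.+1 then
    let: (al, old) := stage t' in
    let picked C :=
      nominee (fun j => [exists u, [&& id u == j, al u & t' < 2 ^ level u]])
        (old C) C in
    (fun v => al v && survives (id v) picked old (X v),
     fun C => if picked C is Some j then j :: old C else old C)
  else (xpredT, fun=> [::]).

Definition active t := (stage t).1.
Definition chosen t := (stage t).2.
Definition eligible t j := [exists u, [&& id u == j, active t u & t < 2 ^ level u]].
Definition choice t C := nominee (eligible t) (chosen t C) C.

Lemma activeS t v :
  active t.+1 v = active t v && survives (id v) (choice t) (chosen t) (X v).
Proof. by rewrite /choice /eligible /active /chosen /=; case: (stage t). Qed.

Lemma chosenS t C :
  chosen t.+1 C = if choice t C is Some j then j :: chosen t C else chosen t C.
Proof. by rewrite /choice /eligible /active /chosen /=; case: (stage t). Qed.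

Lemma eligibleE t u : eligible t (id u) = active t u && (t < 2 ^ level u).
Proof.
apply/existsP/idP => [[w /and3P[/eqP/id_inj -> -> //]]|act_u].
by exists u; rewrite eqxx.
Qed.

Lemma mem_ids (C : {set V}) v : (id v \in [fset id u | u in C]%fset) = (v \in C).
Proof.
apply/imfsetP/idP => [[u Cu /id_inj -> //]|Cv]; by exists v.
Qed.

Lemma clique_inputP v (C : {fset nat}) :
  reflect (exists2 C0 : {set V}, C0 \in Q /\ v \in C0 & C = [fset id u | u in C0]%fset)
    (C \in X v).
Proof.
apply: (iffP idP) => [/imfsetP[C0 /=]|[C0 [QC0 C0v] ->]].
  by rewrite inE => /andP[]; exists C0.
by apply/imfsetP; exists C0; rewrite //= inE QC0.
Qed.

Lemma clique_input_self v C : C \in X v -> id v \in C.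
Proof. by case/clique_inputP => C0 [_ C0v ->]; rewrite mem_ids. Qed.

Lemma clique_input_member v C j : C \in X v -> j \in C -> j <> id v ->
  exists u, [/\ j = id u, e v u & C \in X u].
Proof.
case/clique_inputP => C0 [QC0 C0v ->] /imfsetP[u /= C0u ->] neq_uv.
exists u; split=> //; last by apply/clique_inputP; exists C0.
by case: cover => cl _ _; apply: (cl C0) => // eq_vu; apply: neq_uv; rewrite eq_vu.
Qed.

Lemma clique_input_edge u v : e u v -> exists2 C, C \in X u & C \in X v.
Proof.
case: cover => _ _ ed /ed [C0 [QC0 C0u C0v]].
by exists [fset id u | u in C0]%fset; apply/clique_inputP; exists C0.
Qed.

Definition settled t v := all (fun C => id v \in chosen t C) (X v).

Lemma chosen_mono t C j : j \in chosen t C -> j \in chosen t.+1 C.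
Proof. by rewrite chosenS; case: (choice t C) => // i; rewrite in_cons orbC => ->. Qed.

Lemma settledS t v : settled t v -> settled t.+1 v.
Proof. by move=> /allP st; apply/allP => C /st /chosen_mono. Qed.

Lemma settled_le s t v : s <= t -> settled s v -> settled t v.
Proof.
by move=> /subnK <- st; elim: (t - s) => // i; rewrite addSn => /settledS.
Qed.

Lemma active_mono s t v : s <= t -> active t v -> active s v.
Proof.
by move=> /subnK <-; elim: (t - s) => // i IHi; rewrite addSn activeS => /andP[/IHi].
Qed.

Lemma active_settled s t v : s <= t -> settled s v -> active s v -> active t v.
Proof.
move=> /subnK <- st act; elim: (t - s) => // i IHi; rewrite addSn activeS IHi.
by apply/orP; right; apply: settled_le st; rewrite leq_addl.
Qed.

(** A clique never nominates a node twice, so each stage survived by a nomination adds a new clique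
    to the count; otherwise all cliques are already counted. *)
Lemma active_count t v : active t v ->
  minn t #|` X v| <= count (fun C => id v \in chosen t C) (X v).
Proof.
elim: t => [|t IHt]; first by rewrite min0n.
rewrite activeS => /andP[/IHt {}IHt /orP[/hasP[C XC /eqP ch]|]].
  apply: (@leq_trans (count (fun C => id v \in chosen t C) (X v)).+1); first lia.
  apply: (@ltn_count _ _ _ _ C) => // [C'||].
  - exact: chosen_mono.
  - by rewrite chosenS ch mem_head.
  - by case: (nomineeP ch).
move=> /(@settledS t v); rewrite /settled all_count => /eqP ->.
by rewrite geq_minr.
Qed.

Lemma active_is_settled t v : #|` X v| <= t -> active t v -> settled t v.
Proof.
move=> k_le /active_count; rewrite (minn_idPr k_le) /settled all_count => k_le'.
by rewrite eqn_leq count_size.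
Qed.

Lemma card_le_level v : #|` X v| <= 2 ^ level v.
Proof. exact: up_logP. Qed.

Lemma active_level_settled v : active (2 ^ level v) v -> settled (2 ^ level v) v.
Proof. exact: active_is_settled (card_le_level v). Qed.

Lemma active_forever s t v : 2 ^ level v <= s -> active s v -> active t v.
Proof.
move=> s_ge act; have act0 := active_mono s_ge act.
have [t_ge|/ltnW t_lt] := leqP (2 ^ level v) t; last exact: active_mono t_lt act0.
exact: active_settled t_ge (active_level_settled act0) act0.
Qed.

(** A clique of [v] that has not nominated [v] could do so now, since [v] announces itself at least
    until it is settled. So it nominates some member, which survives. *)
Lemma active_next t v : active t v -> exists2 w, active t.+1 w & w = v \/ e v w.
Proof.
move=> act; have [st|] := boolP (settled t v).
  by exists v; [rewrite activeS act /survives [X in _ || X]st orbT|left].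
case/allPn => C XC not_chosen.
have lt_t : t < 2 ^ level v.
  rewrite ltnNge; apply/negP => t_ge.
  have := active_is_settled (leq_trans (card_le_level v) t_ge) act.
  by move/allP/(_ C XC); exact/negP.
have : choice t C.
  by apply: nominee_some not_chosen; rewrite ?eligibleE ?act // clique_input_self.
case ch: (choice t C) => [j|//] _; have [Cj el_j _] := nomineeP ch.
have {el_j} [w /and3P[/eqP j_w act_w _]] := existsP el_j; subst j.
exists w.
  rewrite activeS act_w; apply/orP; left; apply/hasP; exists C; last by rewrite ch.
  have [->//|neq_wv] := eqVneq w v.
  have [|u [/id_inj <- _ //]] := clique_input_member XC Cj.
  by move=> /id_inj/eqP; exact/negP.
have [->|neq_wv] := eqVneq w v; [by left|right].
have [|u [/id_inj <- //]] := clique_input_member XC Cj.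
by move=> /id_inj/eqP; exact/negP.
Qed.

Lemma active_dist t v : exists2 w, active t w & dist_le e v w t.
Proof.
elim: t => [|t [w act [p [path_p last_p size_p]]]].
  by exists v => //; exists [::].
have [x act_x [eq_xw|e_wx]] := active_next act; exists x => //.
  by exists p; split; rewrite ?eq_xw // (leqW size_p).
by exists (rcons p x); rewrite rcons_path path_p last_p last_rcons size_rcons.
Qed.

Lemma size_chosen t C : size (chosen t C) <= t.
Proof.
elim: t => // t IHt; rewrite chosenS; case: (choice t C) => //; exact: leqW.
Qed.

Lemma card_le_diversity v : #|` X v| <= diversity Q.
Proof.
apply: leq_trans (leq_bigmax v).
by rewrite cardE; apply: leq_trans (leq_imfset_card _ _ _) _.
Qed.

(* Enumerated in the order of the set of IDs, which is the one the algorithm sees. *)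
Definition neighbors v : seq V :=
  pmap (fun j => [pick u | id u == j]) [fset id u | u in e v]%fset.

Lemma map_id_neighbors v :
  [seq id u | u <- neighbors v] = [fset id u | u in e v]%fset.
Proof.
rewrite /neighbors (pmap_filter (g := id)) => [|j]; last first.
  by case: pickP => [u /eqP|] //=.
apply/all_filterP/allP => _ /imfsetP[u _ ->] /=.
by case: pickP => // /(_ u); rewrite eqxx.
Qed.

Lemma mem_neighbors v u : (u \in neighbors v) = e v u.
Proof.
rewrite -(mem_map id_inj) map_id_neighbors.
by apply/imfsetP/idP => [[w ew /id_inj -> //]|evu]; exists u.
Qed.

Lemma neighbors_uniq v : uniq (neighbors v).
Proof. by rewrite -(map_inj_uniq id_inj) map_id_neighbors fset_uniq. Qed.

(** Activity is read at the stage from which active nodes of this level stay active for good. *)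
Definition peers v : seq V :=
  [seq u <- neighbors v | (level u == level v) && active (2 ^ level v) u].

Lemma mem_peers v u :
  (u \in peers v) = [&& e v u, level u == level v & active (2 ^ level v) u].
Proof. by rewrite mem_filter mem_neighbors andbC. Qed.

(** Every peer shares a clique with [v] and, being settled, has been nominated by it. There are at
    most [2 ^ level v] cliques, with at most [2 ^ level v] nominations each. *)
Lemma size_peers v : size (peers v) <= 2 ^ (2 * level v).
Proof.
rewrite mul2n -addnn expnD.
apply: leq_trans (leq_mul (card_le_level v) (leqnn _)).
apply: (@leq_trans (size (flatten [seq chosen (2 ^ level v) C | C <- X v]))).
  rewrite -(size_map id); apply: uniq_leq_size.
    by rewrite (map_inj_uniq id_inj) filter_uniq ?neighbors_uniq.
  move=> _ /mapP[u + ->]; rewrite mem_peers => /and3P[evu /eqP lev_u act_u].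
  have [C XCv XCu] := clique_input_edge evu.
  apply/flatten_mapP; exists C => //.
  by rewrite -lev_u in act_u *; have /allP := active_level_settled act_u; exact.
rewrite size_flatten /shape -map_comp.
elim: (enum_fset (X v)) => //= C s IHs; rewrite mulSn leq_add ?size_chosen //.
Qed.

End Elimination.

(** * The algorithm *)

Definition color_bits (c n l i : nat) : nat := iter i (shrink (2 * l)) (c * bitlen n).

(* The selection of level [l] runs from [window] to [closing], with four digit
   positions of [4 * 2 ^ l] rounds each, and ends before the window of level [l + 1]. *)
Definition window (c n l : nat) : nat := color_rounds c n + 20 * 2 ^ l.

Definition closing (c n l : nat) : nat := window c n l + 16 * 2 ^ l.

(** The additional round delivers the [joins] bit. *)
Definition halt (c n l : nat) : nat := (closing c n l).+1.

Definition base (l : nat) : nat := 4 * 2 ^ l.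

Definition turn_digit (c n l t x : nat) : nat :=
  digit (base l) ((t - window c n l) %/ base l) x.

Definition turn (c n l t : nat) : nat := (t - window c n l) %% base l.

Definition announces (c n l t : nat) (on : bool) (x : nat) : bool :=
  [&& on, window c n l <= t < closing c n l & turn_digit c n l t x == turn c n l t].

Definition joins (c n l t : nat) (on : bool) : bool := on && (t == closing c n l).

(* These bits precede the color in every message. The first one takes part in the
   nominations, the second one lets active nodes of the same level recognize each
   other, the third one eliminates neighbors of the same level and the last one
   neighbors of higher levels. *)
Definition header (c n l t : nat) (act cand : bool) (x : nat) : seq bool :=
  [:: act && (t < 2 ^ l); act && (t == 2 ^ l);
      announces c n l t (act && cand) x; joins c n l t (act && cand)].

(* [picks C] lists the IDs nominated so far by the clique [C], [mates] the IDs of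
   the active neighbors of the same level, and [hue] is the current color. *)
Record node := Node {
  net : nat;
  name : nat;
  nbrs : {fset nat};
  cliques : {fset {fset nat}};
  clock : nat;
  act : bool;
  picks : {fset nat} -> seq nat;
  mates : seq nat;
  hue : nat;
  cand : bool
}.

Definition node_level (s : node) : nat := up_log 2 #|` cliques s|.

Definition node_init (n i : nat) (N : {fset nat}) (X : {fset {fset nat}}) : node :=
  Node n i N X 0 true (fun=> [::]) [::] i true.

Definition node_send (c : nat) (s : node) (j : nat) : seq bool :=
  header c (net s) (node_level s) (clock s) (act s) (cand s) (hue s) ++
  to_bits (c * bitlen (net s)) (hue s).

(** A node gets no message from itself, so it computes its own eligibility bit; [picks] is
    meaningful only on its own cliques. *)
Definition node_recv (c : nat) (s : node) (m : nat -> seq bool) : node :=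
  let: Node n i N X t a old P x b := s in
  let l := node_level s in
  let el j := if j == i then a && (t < 2 ^ l) else nth false (m j) 0 in
  let picked C := nominee el (old C) C in
  Node n i N X t.+1
    (a && survives i picked old X)
    (fun C => if picked C is Some j then j :: old C else old C)
    (if t == 2 ^ l then [seq j <- N | nth false (m j) 1] else P)
    (* The mates are recorded in round [2 ^ l], so recoloring number [i] happens in round
       [(2 ^ l).+1 + i]. *)
    (if 2 ^ l < t <= 2 ^ l + color_rounds c n then
       recolor (2 * l) (color_bits c n l (t - (2 ^ l).+1)) x
         [seq of_bits (drop 4 (m j)) | j <- P]
     else x)
    [&& b, ~~ has (fun j => nth false (m j) 3) N &
        ~~ has (fun j => nth false (m j) 2 && (turn c n l t < turn_digit c n l t x)) P].

Definition node_output (c : nat) (s : node) : option bool :=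
  if clock s < halt c (net s) (node_level s) then None else Some (act s && cand s).

Definition ruling_algorithm (c : nat) : algorithm {fset {fset nat}} bool :=
  Algorithm node_init (node_send c) (node_recv c) (node_output c).

(** * The run of the algorithm in closed form *)

Section Simulation.

Variables (c : nat) (V : finType) (e : rel V) (id : V -> nat) (Q : {set {set V}}).
Hypothesis simple_e : simple_graph e.
Hypothesis ids : valid_ids c id.
Hypothesis cover : clique_edge_cover e Q.

Let id_inj : injective id := proj1 ids.

Local Notation n := #|V|.
Local Notation X := (clique_input id Q).
Local Notation level := (level id Q).
Local Notation active := (active id Q).
Local Notation chosen := (chosen id Q).
Local Notation neighbors := (neighbors e id).
Local Notation peers := (peers e id Q).

Fixpoint color (i : nat) (v : V) : nat :=
  if i is i'.+1 then
    recolor (2 * level v) (color_bits c n (level v) i') (color i' v)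
      [seq color i' u | u <- peers v]
  else id v.

(** Truncated subtraction keeps the ID as color until the mates are known. *)
Definition color_at t v := color (minn (t - (2 ^ level v).+1) (color_rounds c n)) v.

Fixpoint candidate (t : nat) (v : V) : bool :=
  if t is t'.+1 then
    [&& candidate t' v,
        ~~ has (fun u => joins c n (level u) t' (active t' u && candidate t' u))
             (neighbors v) &
        ~~ has (fun u =>
             announces c n (level u) t' (active t' u && candidate t' u)
               (color_at t' u) &&
             (turn c n (level v) t' < turn_digit c n (level v) t' (color_at t' v)))
             (peers v)]
  else true.

Lemma color_lt i v : color i v < 2 ^ color_bits c n (level v) i.
Proof.
elim: i v => [|i IHi] v /=; first by case: ids.
apply: recolor_lt; rewrite ?size_map ?size_peers // => _ /mapP[u + ->].
by rewrite mem_peers // => /and3P[_ /eqP <- _].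
Qed.

Lemma peers_sym u v : active (2 ^ level v) v -> u \in peers v -> v \in peers u.
Proof.
rewrite !mem_peers // => act_v /and3P[evu /eqP -> _].
by case: simple_e => sym_e _; rewrite sym_e evu eqxx.
Qed.

(** Since [v] is active, it is in turn a peer of [u]; hence [u] sees the color of [v] when it
    recolors. *)
Lemma color_neq i u v : active (2 ^ level v) v -> u \in peers v ->
  color i u != color i v.
Proof.
move=> act_v uv; have vu := peers_sym act_v uv.
have lev : level u = level v by move: uv; rewrite mem_peers // => /and3P[_ /eqP].
elim: i => [|i IHi] /=.
  rewrite (inj_eq id_inj); apply: contraTneq uv => ->.
  by case: simple_e => _ irr_e; rewrite mem_peers // irr_e.
have peer_lt w z : z \in [seq color i u | u <- peers w] ->
    z < 2 ^ color_bits c n (level w) i.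
  case/mapP => x; rewrite mem_peers // => /and3P[_ /eqP <- _] ->; exact: color_lt.
rewrite lev; apply: recolor_neq => //;
  rewrite ?size_map -?{1}lev ?size_peers ?color_lt //.
- exact: peer_lt.
- exact: map_f.
Qed.

Lemma color_at_lt t v : color_at t v < 2 ^ (c * bitlen n).
Proof.
by apply: leq_trans (color_lt _ _) _; rewrite leq_exp2l // leq_iter_shrink.
Qed.

Lemma level_before_window l : (2 ^ l).+1 + color_rounds c n <= window c n l.
Proof. by rewrite /window; have : 0 < 2 ^ l by [rewrite expn_gt0]; lia. Qed.

Definition state_spec t v (s : node) : Prop :=
  [/\ [/\ net s = n, name s = id v, nbrs s = [fset id u | u in e v]%fset,
          cliques s = X v & clock s = t],
      act s = active t v /\ {in X v, picks s =1 chosen t},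
      mates s = if 2 ^ level v < t then [seq id u | u <- peers v] else [::],
      hue s = color_at t v & cand s = candidate t v].

Local Notation state t v := (run (ruling_algorithm c) e id X t v).

Definition bulletin t v :=
  header c n (level v) t (active t v) (candidate t v) (color_at t v).

(** A stopped node is silent, whereas [active] and [candidate] are defined for all times; the two
    views agree because all header bits are then false. *)
Lemma bulletin_halt t v i :
  halt c n (level v) <= t -> nth false (bulletin t v) i = false.
Proof.
rewrite /halt /closing => t_ge; have := level_before_window (level v) => w_gt.
case: i => [|[|[|[|i]]]] /=; last by rewrite nth_nil.
- by rewrite ltnNge (_ : 2 ^ _ <= t) ?andbF //; lia.
- by rewrite gtn_eqF ?andbF //; lia.
- by rewrite /announces /closing (ltnNge t) (ltnW t_ge) !andbF.
- by rewrite /joins /closing gtn_eqF ?andbF.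
Qed.

Section Step.

Variable t : nat.
Hypothesis IHt : forall v, state_spec (minn t (halt c n (level v))) v (state t v).

Lemma output_running v : output (state t v) =
  if t < halt c n (level v) then None else
  Some (active (halt c n (level v)) v && candidate (halt c n (level v)) v).
Proof.
case: (IHt v) => -[net_v _ _ X_v clock_v] [act_v _] _ _ cand_v.
rewrite /= /node_output net_v /node_level X_v clock_v act_v cand_v -/(level v).
by case: (leqP (halt c n (level v)) t) => [t_ge|t_lt]; rewrite ?ltnn ?t_lt.
Qed.

Lemma message_running v j : message (state t v) j =
  if t < halt c n (level v) then bulletin t v ++ to_bits (c * bitlen n) (color_at t v)
  else [::].
Proof.
rewrite /message output_running; case: ifP => // t_lt.
case: (IHt v) => -[net_v _ _ X_v clock_v] [act_v _] _ hue_v cand_v.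
rewrite /= /node_send net_v /node_level X_v clock_v act_v cand_v hue_v -/(level v).
by rewrite (minn_idPl (ltnW t_lt)).
Qed.

Lemma inbox_running u v : e v u -> inbox e id (fun w => state t w) v (id u) =
  if t < halt c n (level u) then bulletin t u ++ to_bits (c * bitlen n) (color_at t u)
  else [::].
Proof.
move=> evu; rewrite /inbox; case: pickP => [w /andP[_ /eqP/id_inj ->]|].
  exact: message_running.
by move=> /(_ u) /=; case: simple_e => -> _; rewrite evu eqxx.
Qed.

Lemma inbox_bulletin u v i : i < 4 -> e v u ->
  nth false (inbox e id (fun w => state t w) v (id u)) i = nth false (bulletin t u) i.
Proof.
move=> i_lt evu; rewrite inbox_running //; case: leqP => [t_ge|_].
  by rewrite nth_nil bulletin_halt.
by rewrite nth_cat i_lt.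
Qed.

Lemma inbox_color u v : t < halt c n (level u) -> e v u ->
  of_bits (drop 4 (inbox e id (fun w => state t w) v (id u))) = color_at t u.
Proof.
move=> t_lt evu; rewrite inbox_running // t_lt drop_size_cat //.
by rewrite to_bitsK ?color_at_lt.
Qed.

Lemma has_neighbors (p : pred nat) v :
  has p [fset id u | u in e v]%fset = has (p \o id) (neighbors v).
Proof. by rewrite -(map_id_neighbors e id) has_map. Qed.

Lemma color_atS v : color_at t.+1 v =
  if 2 ^ level v < t <= 2 ^ level v + color_rounds c n then
    recolor (2 * level v) (color_bits c n (level v) (t - (2 ^ level v).+1))
      (color_at t v) [seq color_at t u | u <- peers v]
  else color_at t v.
Proof.
rewrite /color_at; case: ifP => [/andP[t_gt t_le]|out].
  have i_lt : t - (2 ^ level v).+1 < color_rounds c n by rewrite ltn_subLR.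
  rewrite subSS -[in LHS](subnSK t_gt) (minn_idPl i_lt) (minn_idPl (ltnW i_lt)) /=.
  congr recolor; apply/eq_in_map => u; rewrite mem_peers // => /and3P[_ /eqP -> _].
  by rewrite (minn_idPl (ltnW i_lt)).
congr (color _ v); move: (2 ^ level v) out; lia.
Qed.

Lemma nominee_running v C : C \in X v ->
  nominee (fun j => if j == id v then active t v && (t < 2 ^ level v)
                    else nth false (inbox e id (fun w => state t w) v j) 0)
    (chosen t C) C = choice id Q t C.
Proof.
move=> XC; apply: eq_nominee => // j Cj; have [->|/eqP neq_jv] := eqVneq j (id v).
  by rewrite eligibleE.
have [u [-> evu _]] := clique_input_member cover XC Cj neq_jv.
by rewrite inbox_bulletin // eligibleE.
Qed.

Lemma state_step v : state_spec (minn t.+1 (halt c n (level v))) v (state t.+1 v).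
Proof.
have -> : state t.+1 v = if t < halt c n (level v) then
    node_recv c (state t v) (inbox e id (fun w => state t w) v) else state t v.
  rewrite /run iterS {1}/round -/(run _ e id X t v) output_running.
  by case: ifP.
case: leqP => [t_ge|t_lt].
  by have := IHt v; rewrite !(minn_idPr _) // leqW.
have := IHt v; rewrite (minn_idPl (ltnW t_lt)) (minn_idPl t_lt).
case: (state t v) => _ _ _ _ _ a old P x b [/= [-> -> -> -> ->] [-> oldE] -> -> ->].
rewrite /node_level /= -/(level v).
set m := inbox _ _ _ _.
have pickE C : C \in X v ->
    nominee (fun j => if j == id v then active t v && (t < 2 ^ level v)
                      else nth false (m j) 0) (old C) C = choice id Q t C.
  by move=> XC; rewrite oldE // nominee_running.
split=> //=.
- split; last by move=> C XC; rewrite /= pickE // chosenS oldE.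
  rewrite activeS; congr (_ && (_ || _)).
    by apply: eq_in_has => C XC; rewrite pickE.
  by apply: eq_in_all => C XC; rewrite oldE.
- rewrite ltnS; case: (ltngtP t) => // t_eq.
  rewrite /peers -(map_id_neighbors e id) filter_map; congr map.
  apply: eq_in_filter => u; rewrite mem_neighbors // => evu.
  rewrite /= /m inbox_bulletin //= t_eq andbC eqn_exp2l // eq_sym.
  by case: eqVneq => //= ->.
- rewrite color_atS; case: ifP => // /andP[t_gt t_le]; rewrite t_gt; congr recolor.
  rewrite -map_comp; apply/eq_in_map => u; rewrite mem_peers //.
  move=> /and3P[evu /eqP lev _].
  by rewrite /= /m inbox_color // lev.
- congr [&& _, ~~ _ & ~~ _].
    rewrite has_neighbors; apply: eq_in_has => u; rewrite mem_neighbors // => evu.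
    by rewrite /= /m inbox_bulletin.
  case: (ltnP (2 ^ level v) t) => [t_gt|t_le].
    rewrite has_map; apply: eq_in_has => u; rewrite mem_peers // => /and3P[evu _ _].
    by rewrite /= /m inbox_bulletin.
  (* The list of mates is still empty here, but no peer announces itself before the window. *)
  symmetry; apply/negbTE/hasPn => u; rewrite mem_peers // => /and3P[_ /eqP -> _].
  have t_lt' : t < window c n (level v).
    by move: t_le (level_before_window (level v)); move: (2 ^ level v); lia.
  by rewrite /announces (leqNgt (window c n _)) t_lt' !andbF.
Qed.

End Step.

(** A stopped node keeps its state, hence the time capped at [halt]. *)
Lemma runP t v : state_spec (minn t (halt c n (level v))) v (state t v).
Proof.
elim: t v => [|t IHt] v; last exact: state_step.
rewrite min0n; split=> //=.
by rewrite /color_at sub0n min0n.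
Qed.

End Simulation.

(** * Selection *)

Lemma closingE c n l : closing c n l = window c n l + 4 * base l.
Proof. by rewrite /closing /base mulnA. Qed.

Lemma base_gt0 l : 0 < base l.
Proof. by rewrite /base muln_gt0 expn_gt0. Qed.

(** After the coloring rounds, level [l] closes at [36 * 2 ^ l] and the next window opens at
    [40 * 2 ^ l]. *)
Lemma closing_lt_window c n l1 l2 : l1 < l2 -> closing c n l1 < window c n l2.
Proof.
move=> l_lt; rewrite /closing /window -addnA ltn_add2l -mulnDl.
have : 2 ^ l1.+1 <= 2 ^ l2 by rewrite leq_exp2l.
by have : 0 < 2 ^ l1 by [rewrite expn_gt0]; rewrite expnS; lia.
Qed.

Lemma window_le_closing c n l : window c n l <= closing c n l.
Proof. exact: leq_addr. Qed.

Lemma closing_inj c n : injective (closing c n).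
Proof.
move=> l1 l2 eq_cl; case: (ltngtP l1 l2) => // /(closing_lt_window c n) lt_cl.
  by have := window_le_closing c n l2; lia.
by have := window_le_closing c n l1; lia.
Qed.

Lemma turnE c n l i b : b < base l -> turn c n l (window c n l + i * base l + b) = b.
Proof. by move=> b_lt; rewrite /turn -addnA addKn modnMDl modn_small. Qed.

Lemma turn_digitE c n l i b x : b < base l ->
  turn_digit c n l (window c n l + i * base l + b) x = digit (base l) i x.
Proof.
by move=> b_lt; rewrite /turn_digit -addnA addKn divnMDl ?base_gt0 // divn_small ?addn0.
Qed.

Section Selection.

Variables (c : nat) (V : finType) (e : rel V) (id : V -> nat) (Q : {set {set V}}).
Hypothesis simple_e : simple_graph e.
Hypothesis ids : valid_ids c id.
Hypothesis cover : clique_edge_cover e Q.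

Let id_inj : injective id := proj1 ids.

Local Notation n := #|V|.
Local Notation level := (level id Q).
Local Notation active := (active id Q).
Local Notation neighbors := (neighbors e id).
Local Notation peers := (peers e id Q).
Local Notation color := (color c e id Q).
Local Notation color_at := (color_at c e id Q).
Local Notation candidate := (candidate c e id Q).

Lemma candidate_mono s t v : s <= t -> candidate t v -> candidate s v.
Proof.
by move=> /subnK <-; elim: (t - s) => // i IHi; rewrite addSn => /= /and3P[/IHi].
Qed.

Lemma color_at_final t v : window c n (level v) <= t ->
  color_at t v = color (color_rounds c n) v.
Proof.
move=> t_ge; congr (color _ v); apply/minn_idPr.
have := leq_trans (level_before_window c V (level v)) t_ge.
by move=> le_t; rewrite leq_subRL // (leq_trans _ le_t) ?leq_addr.
Qed.

(** The final colors have at most [4 * l + 6] bits, and [base l ^ 4] is [2 ^ (4 * l + 8)]. *)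
Lemma final_color_lt v : color (color_rounds c n) v < base (level v) ^ 4.
Proof.
apply: leq_trans (color_lt ids cover _ _) _.
apply: (@leq_trans (2 ^ (2 * (2 * level v + 3)))).
  by rewrite leq_exp2l // color_bits_final //; apply/card_gt0P; exists v.
by rewrite /base -[4]/(2 ^ 2) -expnD -expnM leq_exp2l //; lia.
Qed.

Definition selected : {set V} :=
  [set v | active (halt c n (level v)) v && candidate (halt c n (level v)) v].

Lemma active_any s t v : window c n (level v) <= s -> active s v -> active t v.
Proof.
move=> s_ge; apply: active_forever.
exact: leq_trans (leq_trans (leqW (leq_addr _ _)) (level_before_window c V _)) s_ge.
Qed.

Lemma mem_peers_active s v u : window c n (level v) <= s -> active s u ->
  e v u -> level u = level v -> u \in peers v.
Proof.
move=> s_ge act_u evu lev; rewrite mem_peers // evu lev eqxx.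
by rewrite (active_any (s := s)) ?lev.
Qed.

Lemma beaten t u v : u \in peers v ->
  window c n (level v) <= t < closing c n (level v) ->
  active t u -> candidate t u ->
  turn_digit c n (level v) t (color_at t u) = turn c n (level v) t ->
  turn c n (level v) t < turn_digit c n (level v) t (color_at t v) ->
  ~~ candidate t.+1 v.
Proof.
move=> uv t_in act_u cand_u dig_u dig_v /=; rewrite !negb_and !negbK.
apply/orP; right; apply/orP; right; apply/hasP; exists u => //.
have /and3P[_ /eqP lev _] : [&& e v u, level u == level v & active (2 ^ level v) u].
  by rewrite -mem_peers.
by rewrite /announces lev act_u cand_u t_in dig_u eqxx.
Qed.

(** In the round of position [i] whose turn is the digit of [u], the node [u] announces itself and
    [v] is eliminated. *)
Lemma beaten_by_digit i u v : u \in peers v -> active (window c n (level v)) u ->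
  candidate (closing c n (level v)) u -> i < 4 ->
  digit (base (level v)) i (color (color_rounds c n) u) <
    digit (base (level v)) i (color (color_rounds c n) v) ->
  ~~ candidate (closing c n (level v)) v.
Proof.
move=> uv act_u cand_u i_lt dig_lt.
set b := digit _ i _ in dig_lt; set l := level v in b cand_u dig_lt *.
have b_lt : b < base l by rewrite ltn_pmod ?base_gt0.
pose t := window c n l + i * base l + b.
have t_lt : t < closing c n l by rewrite closingE /t; nia.
have t_ge : window c n l <= t by rewrite /t -addnA leq_addr.
have lev_u : level u = l by move: uv; rewrite mem_peers // => /and3P[_ /eqP].
apply: contra (candidate_mono t_lt) _.
apply: (@beaten t u v uv); rewrite -/l ?t_lt ?t_ge //.
- by apply: active_any act_u; rewrite lev_u.
- exact: candidate_mono (ltnW t_lt) cand_u.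
- by rewrite color_at_final ?lev_u // turnE // turn_digitE.
- by rewrite color_at_final // turnE // turn_digitE.
Qed.

(** The final colors differ in some digit, and there the smaller digit wins. *)
Lemma rivals_eliminated u v : u \in peers v -> active (window c n (level v)) u ->
  active (window c n (level v)) v ->
  ~~ (candidate (closing c n (level v)) u && candidate (closing c n (level v)) v).
Proof.
move=> uv act_u act_v; apply/negP => /andP[cand_u cand_v].
have act_v0 : active (2 ^ level v) v by apply: active_any act_v.
have vu : v \in peers u by exact: peers_sym simple_e ids _ _ act_v0 uv.
have lev : level u = level v by move: uv; rewrite mem_peers // => /and3P[_ /eqP].
have /eqP := color_neq simple_e ids cover (color_rounds c n) act_v0 uv; apply.
apply: (@digit_inj (base (level v)) 4) => [|||i i_lt]; first exact: base_gt0.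
- by rewrite -lev; exact: final_color_lt.
- exact: final_color_lt.
case: (ltngtP (digit (base (level v)) i (color (color_rounds c n) u))
              (digit (base (level v)) i (color (color_rounds c n) v))) => // dig_lt.
  by have /negP := beaten_by_digit uv act_u cand_u i_lt dig_lt.
rewrite -lev in act_v cand_u cand_v dig_lt.
by have /negP := beaten_by_digit vu act_v cand_v i_lt dig_lt.
Qed.

Lemma lost t v : candidate t v -> ~~ candidate t.+1 v ->
  (exists u, [/\ e v u, t = closing c n (level u), active t u & candidate t u]) \/
  (exists2 u, u \in peers v &
    [/\ window c n (level v) <= t < closing c n (level v), active t u, candidate t u,
        turn_digit c n (level v) t (color_at t u) = turn c n (level v) t &
        turn c n (level v) t < turn_digit c n (level v) t (color_at t v)]).
Proof.
move=> cand_v; rewrite /= cand_v /= negb_and !negbK => /orP[] /hasP[u uv].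
  rewrite mem_neighbors // in uv.
  by move=> /andP[/andP[act_u cand_u] /eqP t_eq]; left; exists u.
move=> /andP[/and3P[/andP[act_u cand_u] t_in /eqP dig_u] dig_v]; right; exists u => //.
by move: uv; rewrite mem_peers // => /and3P[_ /eqP lev _]; rewrite lev in t_in dig_u.
Qed.

(** One round remains. Announcements are over, and a neighbor that joins now has the same level,
    hence is a rival that cannot have remained a candidate. *)
Lemma closing_selected v : active (closing c n (level v)) v ->
  candidate (closing c n (level v)) v -> v \in selected.
Proof.
move=> act_v cand_v; rewrite inE (active_any _ (window_le_closing _ _ _) act_v) /=.
apply: contraT => /(lost cand_v) [[u [evu /closing_inj lev act_u cand_u]]|].
  have uv : u \in peers v.
    by apply: mem_peers_active act_u evu (esym lev); exact: window_le_closing.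
  have := rivals_eliminated uv; rewrite cand_u cand_v; apply.
    by apply: active_any act_u; rewrite lev window_le_closing.
  by apply: active_any act_v; exact: window_le_closing.
by case=> u _ []; rewrite ltnn andbF.
Qed.

Lemma lost_to_closing t v u : e v u -> t = closing c n (level u) -> active t u ->
  candidate t u -> exists2 w, w \in selected & dist_le e v w 1.
Proof.
move=> evu -> act_u cand_u; exists u; first exact: closing_selected.
by exists [:: u]; rewrite /= evu.
Qed.

(** * Distance to the selected nodes and independence *)

Lemma dist_le_trans u v w i j :
  dist_le e u v i -> dist_le e v w j -> dist_le e u w (i + j).
Proof.
move=> [p [path_p last_p size_p]] [q [path_q last_q size_q]].
exists (p ++ q); rewrite cat_path last_cat size_cat last_p path_p path_q last_q.
by rewrite leq_add.
Qed.

Lemma dist_le_sym u v i : dist_le e u v i -> dist_le e v u i.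
Proof.
case: simple_e => sym_e _ [p [path_p <- size_p]].
exists (rev (belast u p)); split; last by rewrite size_rev size_belast.
  by rewrite rev_path (eq_path (e' := e)) // => x y; rewrite sym_e.
by case: p {path_p size_p} => //= x p; rewrite rev_cons last_rcons.
Qed.

Lemma dist_le_leq u v i j : i <= j -> dist_le e u v i -> dist_le e u v j.
Proof.
by move=> le_ij [p [? ? size_p]]; exists p; split=> //; exact: leq_trans size_p _.
Qed.

Lemma first_loss s m v : candidate s v -> ~~ candidate (s + m) v ->
  exists2 t, s <= t < s + m & candidate t v && ~~ candidate t.+1 v.
Proof.
elim: m => [|m IHm] cand_s; first by rewrite addn0 cand_s.
have [cand_m|ncand_m] := boolP (candidate (s + m) v); rewrite addnS.
  by exists (s + m); rewrite ?leq_addr ?ltnSn // cand_m.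
move=> _; have [t /andP[t_ge t_lt] lost_t] := IHm cand_s ncand_m.
by exists t; rewrite // t_ge ltnS ltnW.
Qed.

(* A node eliminated at position [i] has a neighbor that announced itself; this one
   reaches the next position, because later rounds only eliminate larger digits
   and no other level closes inside the window. *)
Lemma winner_survives i t u : i < 4 ->
  let l := level u in
  window c n l + i * base l <= t < window c n l + i.+1 * base l ->
  candidate t u -> turn_digit c n l t (color_at t u) = turn c n l t ->
  candidate (window c n l + i.+1 * base l) u.
Proof.
move=> i_lt l /andP[t_ge t_lt] cand_u dig_u.
apply: contraT => lost_u.
have end_lt : window c n l + i.+1 * base l <= closing c n l.
  by rewrite closingE leq_add2l leq_mul2r i_lt orbT.
have slot t' : window c n l + i * base l <= t' < window c n l + i.+1 * base l ->
    exists2 b, b < base l & t' = window c n l + i * base l + b.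
  move=> /andP[ge lt]; exists (t' - (window c n l + i * base l)).
    by rewrite ltn_subLR // -addnA -mulSnr.
  by rewrite subnKC.
have [|t'] := @first_loss t (window c n l + i.+1 * base l - t) u cand_u.
  by rewrite subnKC // ltnW.
rewrite subnKC; last exact: ltnW.
move=> /andP[t'_ge t'_lt] /andP[cand' lost'].
have [b b_lt t_eq] : exists2 b, b < base l & t = window c n l + i * base l + b.
  by apply: slot; rewrite t_ge.
have [b' b'_lt t'_eq] : exists2 b, b < base l & t' = window c n l + i * base l + b.
  by apply: slot; rewrite (leq_trans t_ge).
have [[x [_ t'_cl _ _]]|[x _ [_ _ _ _]]] := lost cand' lost'.
  have [lt_xl|] := ltnP (level x) l.
    have := closing_lt_window c n lt_xl; rewrite -t'_cl => lt'.
    by have : window c n l <= t' by [rewrite t'_eq -addnA leq_addr]; lia.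
  rewrite leq_eqVlt => /predU1P[eq_l|/(closing_lt_window c n) lt_lx].
    by move: t'_lt; rewrite t'_cl -eq_l; lia.
  by have := window_le_closing c n (level x); lia.
rewrite color_at_final -/l; last by rewrite t'_eq -addnA leq_addr.
move: dig_u; rewrite color_at_final -/l; last by rewrite t_eq -addnA leq_addr.
by rewrite {1 2}t_eq t'_eq !turn_digitE // !turnE // => ->; lia.
Qed.

(** Induction on the number [j] of positions left. Either [v] passes the next one, or a joining
    neighbor is selected, or a peer beats [v] and passes the position itself, at the cost of one
    edge. *)
Lemma candidate_dominated j v : j <= 4 -> active (window c n (level v)) v ->
  candidate (window c n (level v) + (4 - j) * base (level v)) v ->
  exists2 w, w \in selected & dist_le e v w j.
Proof.
elim: j v => [|j IHj] v j_le act_v cand_v.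
  exists v; last by exists [::].
  apply: closing_selected; last by rewrite closingE.
  by apply: active_any act_v.
(* With [j.+1] positions left, the current one has index [3 - j]. *)
set l := level v in act_v cand_v *; have i_lt : 3 - j < 4 by lia.
have ij : 4 - j = (3 - j).+1 by lia.
rewrite (_ : 4 - j.+1 = 3 - j) in cand_v; last lia.
have [cand_next|lost_v] := boolP (candidate (window c n l + (4 - j) * base l) v).
  have [w Rw dist_w] := IHj v (ltnW j_le) act_v cand_next.
  by exists w => //; apply: dist_le_leq dist_w.
rewrite ij mulSnr addnA in lost_v.
have [t t_in /andP[cand_t lost_t]] := first_loss cand_v lost_v.
have [[u [evu t_cl act_u cand_u]]|] := lost cand_t lost_t.
  have [w Rw dist_w] := lost_to_closing evu t_cl act_u cand_u.
  by exists w => //; apply: dist_le_leq dist_w.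
move=> [u uv [t_in' act_u cand_u dig_u _]].
have /and3P[evu /eqP lev _] : [&& e v u, level u == level v & active (2 ^ level v) u].
  by rewrite -mem_peers.
have [||w Rw dist_w] := IHj u (ltnW j_le).
- by rewrite lev; case/andP: t_in' => w_le _; apply: active_any act_u; rewrite lev.
- rewrite ij; apply: (@winner_survives _ t) => //; rewrite lev //.
  by rewrite mulSnr addnA.
exists w => //; rewrite -add1n; apply: dist_le_trans dist_w.
by exists [:: u]; rewrite /= evu.
Qed.

(** Before its window, [v] can only lose to a joining neighbor, which is selected. *)
Lemma active_dominated v : active (2 ^ level v) v ->
  exists2 w, w \in selected & dist_le e v w 4.
Proof.
move=> act; have act_v t : active t v by exact: active_forever act.
have [cand_v|lost_v] := boolP (candidate (window c n (level v)) v).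
  by apply: candidate_dominated; rewrite ?subnn ?addn0.
rewrite -[window c n _]add0n in lost_v.
have [//|t t_in /andP[cand_t lost_t]] := first_loss _ lost_v.
have [[u [evu t_cl act_u cand_u]]|[u _ [/andP[w_le _] _ _ _ _]]] := lost cand_t lost_t.
  have [w Rw dist_w] := lost_to_closing evu t_cl act_u cand_u.
  by exists w => //; apply: dist_le_leq dist_w.
by move: t_in; rewrite add0n; lia.
Qed.

(** At equal levels the two are rivals. Otherwise the node of lower level joins before the window of
    the other one opens, and eliminates it. *)
Lemma selected_independent u v : u \in selected -> v \in selected -> ~~ e u v.
Proof.
case: simple_e => sym_e _.
wlog lev_le : u v / level u <= level v => [wlog_uv|].
  have [/wlog_uv //|/ltnW/wlog_uv wlog_vu Ru Rv] := leqP (level u) (level v).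
  by rewrite sym_e wlog_vu.
rewrite !inE => /andP[act_u cand_u] /andP[act_v cand_v]; apply/negP => euv.
have evu : e v u by rewrite sym_e.
have w_le x : window c n (level x) <= halt c n (level x).
  exact: leqW (window_le_closing _ _ _).
have act_u' t : active t u by apply: active_any act_u.
have act_v' t : active t v by apply: active_any act_v.
have cand_u' := candidate_mono (leqnSn _) cand_u.
have cand_v' := candidate_mono (leqnSn _) cand_v.
move: lev_le; rewrite leq_eqVlt => /predU1P[lev|lev_lt].
  have uv : u \in peers v by exact: mem_peers_active (leqnn _) (act_u' _) evu lev.
  have := rivals_eliminated uv (act_u' _) (act_v' _).
  by rewrite -{1}lev cand_u' cand_v'.
have halt_le : halt c n (level u) <= closing c n (level v).
  exact: leq_trans (closing_lt_window c n lev_lt) (window_le_closing _ _ _).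
have /= /and3P[_ /hasPn/(_ u) + _] := candidate_mono halt_le cand_v'.
rewrite mem_neighbors // evu => /(_ isT).
by rewrite /joins act_u' cand_u' eqxx.
Qed.

Lemma active_diversity t v : diversity Q <= t -> active (diversity Q) v -> active t v.
Proof.
move=> D_le act_v; apply: active_settled D_le _ (act_v).
exact: active_is_settled (card_le_diversity id Q v) act_v.
Qed.

Lemma selected_ruling : ruling_set e 2 (diversity Q + 4) selected.
Proof.
split=> [u v Ru Rv neq_uv p|v].
  case: p => [|x [|y p]] //= path_p last_p.
  by case/negP: (selected_independent Ru Rv); rewrite -last_p; case/andP: path_p.
have [w act_w dist_w] := active_dist id_inj cover (diversity Q) v.
have [|r Rr dist_r] := @active_dominated w.
  (* A node active after [diversity Q] stages is settled, so it is active at every stage. *)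
  have [le|/ltnW le] := leqP (diversity Q) (2 ^ level w).
    exact: active_diversity le act_w.
  exact: active_mono le act_w.
by exists r => //; apply: dist_le_sym; exact: dist_le_trans dist_w dist_r.
Qed.

(** Rounding up to a power of two at most doubles, so [36 * 2 ^ level v] is at most
    [72 * diversity Q]. The constant terms are absorbed since every node lies in a clique and the
    diversity is positive. *)
Lemma halt_bound v :
  halt c n (level v) <= (2 ^ (c + 6) + 80) * (diversity Q + log_star n).
Proof.
have k_gt0 : 0 < #|` clique_input id Q v|.
  case: cover => _ cov _; have [C QC Cv] := cov v; rewrite cardfs_gt0.
  apply/fset0Pn; exists [fset id u | u in C]%fset.
  by apply/clique_inputP; exists C.
have k_le := card_le_diversity id Q v.
have : 2 ^ level v <= 2 * #|` clique_input id Q v|.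
  rewrite /level; case: (ltnP 1 #|` clique_input id Q v|) => [k_gt1|k_le1].
    have := up_log_gtn (ltnSn 1) k_gt1.
    rewrite -[X in _ -> 2 ^ X <= _]prednK ?up_log_gt0 ?k_gt1 // expnS; lia.
  by rewrite (_ : #|` _| = 1) ?up_log1 //; apply/eqP; rewrite eqn_leq k_le1.
rewrite /halt /closing /window /color_rounds; nia.
Qed.

End Selection.

Theorem theorem5 (c : nat) :
  exists (A : algorithm {fset {fset nat}} bool) (b K : nat),
  forall (n D : nat) (V : finType) (e : rel V) (id : V -> nat)
    (Q : {set {set V}}),
  #|V| = n ->
  simple_graph e ->
  valid_ids c id ->
  clique_edge_cover e Q ->
  diversity Q = D ->
  bandwidth_le A e id (clique_input id Q) (b * bitlen n) /\
  exists (t : nat) (R : {set V}),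
    [/\ t <= K * (D + log_star n),
        computes_in A e id (clique_input id Q) t R
      & ruling_set e 2 (D + 4) R].
Proof.
(* A message is a color of [c * bitlen n] bits after 4 header bits. *)
exists (ruling_algorithm c), (c + 4), (2 ^ (c + 6) + 80).
move=> n D V e id Q <- simple_e ids cover <-; split=> [t u v euv|].
  rewrite (message_running (runP simple_e ids cover t)); case: ifP => // _.
  by rewrite size_cat size_to_bits /= mulnDl /bitlen; lia.
(* Nodes stop at different times; this common bound serves all levels. *)
exists ((2 ^ (c + 6) + 80) * (diversity Q + log_star #|V|)).
exists (selected c e id Q); split=> //; last exact: selected_ruling.
move=> v; rewrite (output_running (runP simple_e ids cover _)).
by rewrite ltnNge (halt_bound c id cover) inE.
Qed.
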